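(* Let the maximum side-ramp recursion index of the ReRamp algorithm be $i_r\ge1$. The worst-case ReRamp algorithm maximum construction height is $\Omega(\sqrt{n_a})$, where $n_a$ is the maximum construction height in the ramp area $a$; that is, there are positive constants $C,n_0$ such that for every ramp area $a$ with $n_a\ge n_0$ the worst-case maximum construction height of the ReRamp algorithm in $a$ is at least $C\sqrt{n_a}$.
   Context: **Setting.** Let $\widehat{i}=\{0,\dots,i-1\}$. Grid positions $\mathcal{P}=\widehat X\times\widehat Y$, neighbors $\mathcal{N}_{(x,y)}=\{(x\pm1,y),(x,y\pm1)\}\cap\mathcal{P}$; $z_{t,x,y}$ is the number of blocks at $(x,y)$ at timestep $t$. Border positions have $x\in\{0,X-1\}$ or $y\in\{0,Y-1\}$ and never contain blocks; $\mathcal{P}_\boxdot$ is the set of non-border positions. Agents stand on top of columns, carry at most one block, and can: enter/leave at a border position; move to a neighbor if heights differ by at most $1$; deliver the carried block to a neighbor of equal height (before the action); pick up the top block of a neighbor whose height equals the agent's height after the action; wait. At most one agent or block occupies a cell, and simultaneous actions of different agents must involve disjoint sets of positions. A ramp area is a connected component, having a position neighboring some border position, of the grid graph induced on non-border positions of current height $0$. The maximum construction height $n_a$ in a ramp area $a$ is the maximum height (number of blocks in the highest column) of any ramp within $a$, i.e. of any arrangement of blocks on the (initially empty) positions of $a$ obtainable by a finite sequence of admissible agent actions, starting with no agents on the grid, in which agents only stand on positions of $a$ and border positions and only deliver to or pick up from positions of $a$. **Compound ramps.** A (compound) ramp is a tuple $(p,\mathcal{S},f)$, with central path $p=v_0,\dots,v_k$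 ($v_0\in\mathcal{P}$ the connection point $c_\odot p$; $v_1,\dots,v_k\in\mathcal{P}_\boxdot$; last node $l_p$), a sequence $\mathcal{S}$ of reversible ramps (side ramps) attached by their connection points to nodes of $p$, and floor height $f$. The relative reversible height $\mathrm{rrh}_t(s)$ of a reversible ramp $s$ at time $t$ is its height relative to its floor in its backward state when all its backward side ramps are also reversed. The ramp is valid if all its side ramps are reversible and at all times each $(x,y)\in p$ with successor $(x',y')$ satisfies $0\le z_{t,x',y'}-z_{t,x,y}\le1+\sum_{s\in\mathcal{S}:c_\odot s=(x,y)}\mathrm{rrh}_t(s)$. A ramp is reversible if it is valid and there is a pair (forward ramp, backward ramp) of ramps with the same floor height and a sequence of actions moving all blocks from the forward ramp (initially holding all blocks) to the backward ramp (initially empty). To move up the central path, an agent reverses one by one (in the order of $\mathcal{S}$) the side ramps attached to its current node to the backward state, stands on the highest block of the last one and steps to the next node; moving down is the reverse process. The maximum reversible height $\mathrm{rrh}(s)$ of a ramp $s$ is obtained by extending the backward ramp from one end of the central path of $s$ and the forward ramp from the other end, keeping the backward ramp's capacity at most that of the forward ramp, until the two connection points meet at a pivot node; side ramps at the pivot are assigned to the backward or forward ramp so as to maximize backward height under the capacity constraint; the procedure is repeated with the backward ramp having no side ramps (the forward one still having them), and the backward ramp of larger height is chosen; $\mathrm{rrh}(s)$ is its height. A ramp is full when all side ramps are at reversible capacity (the capacity of their backward ramp), successive central-path heights differ by $1+\sum_{s:c_\odot s=v_i}\mathrm{rrh}(s)$, and side ramps at $l_p$, when reversed, together reach $\sum_{s:c_\odot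 s=l_p}\mathrm{rrh}(s)$ above the floor of the first one; its capacity is its number of blocks above the floor when full. **RFT (ramp from tree).** Input: rooted tree, node $v_k$, index $i_r$. Starting from $v_i=v_k$, while $v_i$ is not the root: add $v_i$ to the central path; if $i_r>0$, for each child $v_c$ of $v_i$ not in the central path, let $n_d$ be the node farthest from $v_c$ not crossing $v_i$, form the side ramp RFT(the tree rooted at $v_i$, $n_d$, $i_r-1$), and add it to $\mathcal{S}$ if its reversible height is positive; then replace $v_i$ by its parent. Finally add the root to the central path and return $(p,\mathcal{S},0)$. **ReRamp in a ramp area.** To deconstruct (equivalently, by reversing the plan, construct) a structure column next to a position $v_k$ of a ramp area $a$, ReRamp takes a spanning tree of $a$ found by depth-first search, with a border position $v_0$ added as a leaf and taken as the root, forms the ramp $r=\mathrm{RFT}(\text{tree},v_k,i_r)$ and builds it up, at most until it is full. The construction height of ReRamp for this choice is the height of the full ramp $r$ including its reversed side ramps, i.e. $k+\sum_{s\in\mathcal{S}}\mathrm{rrh}(s)$, where $k\ge1$ is the number of edges of the central path. The worst-case maximum construction height in $a$ is the minimum of this quantity over all choices of the border position $v_0$ neighboring $a$, the depth-first-search spanning tree and the position $v_k\in a$. *)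

(* Defs.v *)
From mathcomp Require Import all_boot.

Set Implicit Arguments.
Unset Strict Implicit.
Unset Printing Implicit Defensive.

Definition is_maximum (A : nat -> Prop) (n : nat) : Prop :=
  A n /\ forall m, A m -> m <= n.

Definition is_minimum (A : nat -> Prop) (n : nat) : Prop :=
  A n /\ forall m, A m -> n <= m.

(** * The grid world *)

Definition pos (X Y : nat) : finType := ('I_X * 'I_Y)%type.

Definition neighbor {X Y : nat} (u v : pos X Y) : bool :=
  (u.2 == v.2) && ((u.1.+1 == v.1 :> nat) || (v.1.+1 == u.1 :> nat)) ||
  (u.1 == v.1) && ((u.2.+1 == v.2 :> nat) || (v.2.+1 == u.2 :> nat)).

Definition border {X Y : nat} (u : pos X Y) : bool :=
  [|| u.1 == 0 :> nat, u.1 == X.-1 :> nat, u.2 == 0 :> nat | u.2 == Y.-1 :> nat].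

Definition heights (X Y : nat) := {ffun pos X Y -> nat}.

Definition border_empty {X Y : nat} (z : heights X Y) : Prop :=
  forall u, border u -> z u = 0.

(* An agent always stands on top of a column, so a position carries at most one
   agent: [agent s u] is [None] if there is none at [u], and otherwise
   [Some b] where [b] tells whether it carries a block. *)
Record state (X Y : nat) := State {
  height_of : heights X Y;
  agent : {ffun pos X Y -> option bool} }.

Inductive action (X Y : nat) :=
  | Enter (b : pos X Y) (carry : bool)
  | Leave (b : pos X Y)
  | Move (u v : pos X Y)
  | Deliver (u v : pos X Y)
  | PickUp (u v : pos X Y)
  | Wait (u : pos X Y).

Definition involved {X Y : nat} (c : action X Y) : {set pos X Y} :=
  match c with
  | Enter b _ | Leave b | Wait b => [set b]
  | Move u v | Deliver u v | PickUp u v => [set u; v]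
  end.

(* The position of the acting agent before the action. *)
Definition actor {X Y : nat} (c : action X Y) : option (pos X Y) :=
  match c with
  | Enter _ _ => None
  | Leave u | Move u _ | Deliver u _ | PickUp u _ | Wait u => Some u
  end.

(* The preconditions for actions of agents restricted to the area [a].  That no
   agent occupies the target of an action is enforced in [timestep], since
   the occupant acts (possibly by waiting) and this involves its position. *)
Definition admissible {X Y : nat} (a : {set pos X Y}) (s : state X Y)
    (c : action X Y) : bool :=
  let z := height_of s in
  match c with
  | Enter b _ => border b
  | Leave b => border b && (agent s b != None)
  | Move u v => [&& agent s u != None, neighbor u v, (v \in a) || border v,
                    z v <= (z u).+1 & z u <= (z v).+1]
  | Deliver u v => [&& agent s u == Some true, neighbor u v, v \in a & z v == z u]
  | PickUp u v => [&& agent s u == Some false, neighbor u v, v \in a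
                    & z v == (z u).+1]
  | Wait u => agent s u != None
  end.

Definition update {X Y : nat} {A : Type} (g : {ffun pos X Y -> A})
    (u : pos X Y) (x : A) : {ffun pos X Y -> A} :=
  [ffun w => if w == u then x else g w].

Definition perform {X Y : nat} (s : state X Y) (c : action X Y) : state X Y :=
  let z := height_of s in
  let ag := agent s in
  match c with
  | Enter b carry => State z (update ag b (Some carry))
  | Leave b => State z (update ag b None)
  | Move u v => State z (update (update ag u None) v (ag u))
  | Deliver u v => State (update z v (z v).+1) (update ag u (Some false))
  | PickUp u v => State (update z v (z v).-1) (update ag u (Some true))
  | Wait _ => s
  end.

(* Simultaneous actions of all agents; as they involve disjoint positions, the
   order in which they are performed is irrelevant. *)
Definition timestep {X Y : nat} (a : {set pos X Y}) (s s' : state X Y) : Prop :=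
  exists cs : seq (action X Y),
    [/\ all (admissible a s) cs,
        pairwise (fun c d => [disjoint involved c & involved d]) cs,
        forall u, agent s u != None -> has (fun c => actor c == Some u) cs
      & s' = foldl perform s cs].

Inductive reachable {X Y : nat} (a : {set pos X Y}) (s0 : state X Y) :
    state X Y -> Prop :=
  | reachable_start : reachable a s0 s0
  | reachable_step s s' :
      reachable a s0 s -> timestep a s s' -> reachable a s0 s'.

Definition free_positions {X Y : nat} (z : heights X Y) : {set pos X Y} :=
  [set u | ~~ border u && (z u == 0)].

Definition ramp_area {X Y : nat} (z : heights X Y) (a : {set pos X Y}) : Prop :=
  (exists2 u, u \in free_positions z &
     a = [set v in free_positions z |
           connect [rel x y | [&& x \in free_positions z, y \in free_positions z
                                & neighbor x y]] u v]) /\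
  exists u b, [/\ u \in a, border b & neighbor b u].

Definition ramp_height_in {X Y : nat} (z : heights X Y) (a : {set pos X Y})
    (h : nat) : Prop :=
  exists2 s, reachable a (State z [ffun => None]) s &
    h = \max_(u in a) height_of s u.

Definition max_construction_height {X Y : nat} (z : heights X Y)
    (a : {set pos X Y}) (n : nat) : Prop :=
  is_maximum (ramp_height_in z a) n.

(** * Compound ramps *)

(* [Ramp v0 p sd f] has the central path [v0 :: p], connection point [v0],
   last node [last v0 p] and floor height [f].  A side ramp in [sd] is given
   by its pair (backward ramp, forward ramp): if its own central path is
   w_0, ..., w_m with pivot w_j, these have the central paths
   w_j, w_(j-1), ..., w_0 and w_j, ..., w_m.  The node w_0 it is attached to
   is thus the last, highest node of its backward ramp. *)
Inductive ramp (T : Type) :=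
  Ramp (v0 : T) (p : seq T) (sd : seq (ramp T * ramp T)) (f : nat).

Definition nodes {T : Type} (r : ramp T) : seq T :=
  let: Ramp v0 p _ _ := r in v0 :: p.

Definition attached_at {T : Type} (s : ramp T * ramp T) : T :=
  let: Ramp w p _ _ := s.1 in last w p.

(* Height above the floor of the full ramp, its side ramps being reversed; on
   a backward ramp this is the reversible height. *)
Fixpoint height {T : Type} (r : ramp T) : nat :=
  let: Ramp v0 p sd f := r in size p + sumn [seq height s.1 | s <- sd].

Definition rrh {T : Type} (s : ramp T * ramp T) : nat := height s.1.

(* Number of positions of a ramp other than its connection point.  For a side
   ramp with pivot w_j and last node w_m, the sum of the two areas counts its
   positions other than w_0, since j + (m - j) = m. *)
Fixpoint area {T : Type} (r : ramp T) : nat :=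
  let: Ramp v0 p sd f := r in
  size p + sumn [seq area s.1 + area s.2 | s <- sd].

(* Blocks held, above the floor of the ramp under consideration, by the side
   ramps attached to one node of relative height [g].  Each side ramp is
   listed as (reversible height, area, reversible capacity).  Reversing a side
   ramp lifts the node by its reversible height, so the floor of each side ramp
   is the level reached by reversing the previous ones, and all its positions
   are filled up to that floor. *)
Fixpoint side_blocks (g : nat) (D : seq (nat * nat * nat)) : nat :=
  if D is (h, ar, c) :: D' then g * ar + c + side_blocks (g + h) D' else 0.

(* Relative height of the [i]-th central node of a full ramp. *)
Definition level {T : eqType} (r : ramp T) (i : nat) : nat :=
  let: Ramp v0 p sd f := r in
  sumn [seq (sumn [seq rrh s | s <- sd & attached_at s == v]).+1
       | v <- take i (v0 :: p)].

Fixpoint capacity {T : eqType} (r : ramp T) : nat :=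
  let: Ramp v0 p sd f := r in
  let D := [seq (attached_at s, (rrh s, area s.1 + area s.2, capacity s.1))
           | s <- sd] in
  sumn [seq level r i +
            side_blocks (level r i) [seq d.2 | d <- D & d.1 == nth v0 (v0 :: p) i]
       | i <- iota 0 (size p).+1].

(** * The maximum reversible height *)

Definition sides_before {T : eqType} (r : ramp T) (j : nat) :=
  let: Ramp v0 p sd f := r in [seq s <- sd | index (attached_at s) (v0 :: p) < j].

Definition sides_at {T : eqType} (r : ramp T) (j : nat) :=
  let: Ramp v0 p sd f := r in [seq s <- sd | index (attached_at s) (v0 :: p) == j].

Definition sides_after {T : eqType} (r : ramp T) (j : nat) :=
  let: Ramp v0 p sd f := r in [seq s <- sd | j < index (attached_at s) (v0 :: p)].

Definition backward_ramp {T : eqType} (r : ramp T) (j : nat)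
    (sd' : seq (ramp T * ramp T)) : ramp T :=
  let: Ramp v0 p sd f := r in
  Ramp (nth v0 (v0 :: p) j) (rev (take j (v0 :: p))) sd' f.

Definition forward_ramp {T : eqType} (r : ramp T) (j : nat)
    (sd' : seq (ramp T * ramp T)) : ramp T :=
  let: Ramp v0 p sd f := r in Ramp (nth v0 (v0 :: p) j) (drop j p) sd' f.

(* The backward ramp spans the nodes 0..i and the forward ramp the nodes j..k;
   the backward ramp is extended whenever its capacity allows it, and the
   forward ramp otherwise.  With [fuel] at least j - i, the result is the node
   where the connection points meet. *)
Fixpoint meeting_point (capB capF : nat -> nat) (fuel i j : nat) : nat :=
  if fuel is fuel'.+1 then
    if i < j then
      if capB i.+1 <= capF j then meeting_point capB capF fuel' i.+1 j
      else meeting_point capB capF fuel' i j.-1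
    else i
  else i.

Definition pivot {T : eqType} (r : ramp T)
    (SB SF : nat -> seq (ramp T * ramp T)) : nat :=
  let k := (size (nodes r)).-1 in
  meeting_point (fun i => capacity (backward_ramp r i (SB i)))
                (fun j => capacity (forward_ramp r j (SF j))) k 0 k.

(* While the two ramps are being extended, the side ramps at the current
   connection points are left to the forward ramp; this makes the backward ramp
   reach as far as any assignment of the side ramps at the pivot allows. *)
Definition split_with_sides {T : eqType} (r : ramp T) (BF : ramp T * ramp T) :
    Prop :=
  let j := pivot r (sides_before r) (fun j => sides_at r j ++ sides_after r j) in
  let B m := backward_ramp r j (sides_before r j ++ mask m (sides_at r j)) in
  let F m := forward_ramp r j
               (mask (map negb m) (sides_at r j) ++ sides_after r j) in
  let feasible m := (size m == size (sides_at r j)) &&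
                    (capacity (B m) <= capacity (F m)) in
  exists m : bitseq,
    [/\ feasible m,
        forall m' : bitseq, feasible m' -> height (B m') <= height (B m)
      & BF = (B m, F m)].

Definition split_without_sides {T : eqType} (r : ramp T) : ramp T * ramp T :=
  let SF j := sides_at r j ++ sides_after r j in
  let j := pivot r (fun => [::]) SF in
  (backward_ramp r j [::], forward_ramp r j (SF j)).

Definition reversal {T : eqType} (r : ramp T) (BF : ramp T * ramp T) : Prop :=
  exists2 BF1, split_with_sides r BF1 &
    let BF2 := split_without_sides r in
    BF = BF1 /\ rrh BF2 <= rrh BF1 \/ BF = BF2 /\ rrh BF1 <= rrh BF2.

(** * Ramp from tree *)

(* A tree is given by its list of edges, in either orientation, so that it can
   be rooted at any node. *)
Definition tree_adj {T : eqType} (E : seq (T * T)) : rel T :=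
  fun u v => ((u, v) \in E) || ((v, u) \in E).

Definition simple_path {T : eqType} (E : seq (T * T)) (u : T) (q : seq T) : bool :=
  path (tree_adj E) u q && uniq (u :: q).

Definition farthest {T : eqType} (E : seq (T * T)) (vi vc nd : T) : Prop :=
  exists q : seq T,
    [/\ simple_path E vc q, vi \notin vc :: q, last vc q = nd
      & forall q' : seq T, simple_path E vc q' -> vi \notin vc :: q' ->
          size q' <= size q].

(* The pairs (v_i, v_c) in the order in which RFT processes them: from the end
   of the central path [root :: p] down to its root (excluded), the children of
   each node being taken in any order.  As the parent of v_i is on the central
   path, the children of v_i not on it are its tree neighbors not on it. *)
Definition side_candidates {T : finType} (E : seq (T * T)) (root : T) (p : seq T)
    (cs : seq (T * T)) : Prop :=
  exists2 children : T -> seq T,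
    forall v, perm_eq (children v)
                (enum [pred c | tree_adj E v c && (c \notin root :: p)]) &
    cs = flatten [seq [seq (v, c) | c <- children v] | v <- rev p].

Inductive add_sides {T : eqType} (E : seq (T * T))
    (build : T -> T -> ramp T -> Prop) :
    seq (T * T) -> seq (ramp T * ramp T) -> Prop :=
  | add_sides_nil : add_sides E build [::] [::]
  | add_sides_keep vi vc nd s BF cs sd :
      farthest E vi vc nd -> build vi nd s -> reversal s BF -> 0 < rrh BF ->
      add_sides E build cs sd -> add_sides E build ((vi, vc) :: cs) (BF :: sd)
  | add_sides_skip vi vc nd s BF cs sd :
      farthest E vi vc nd -> build vi nd s -> reversal s BF -> rrh BF = 0 ->
      add_sides E build cs sd -> add_sides E build ((vi, vc) :: cs) sd.

(* [rft E ir root vk r]: the tree [E] rooted at [root], the node [vk] and the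
   index [ir] can yield the ramp [r], whatever way ties are broken. *)
Fixpoint rft {T : finType} (E : seq (T * T)) (ir : nat) (root vk : T)
    (r : ramp T) : Prop :=
  exists p sd,
    [/\ simple_path E root p, last root p = vk, r = Ramp root p sd 0
      & if ir is ir'.+1 then
          exists2 cs, side_candidates E root p cs & add_sides E (rft E ir') cs sd
        else sd = [::]].

(** * ReRamp in a ramp area *)

(* Runs of depth-first search on the graph induced by [e] on [a], from any
   start node: current stack, visited nodes, tree edges found so far. *)
Inductive dfs_run {T : finType} (e : rel T) (a : {set T}) :
    seq T -> {set T} -> seq (T * T) -> Prop :=
  | dfs_start u : u \in a -> dfs_run e a [:: u] [set u] [::]
  | dfs_descend u st V E w :
      dfs_run e a (u :: st) V E -> w \in a -> e u w -> w \notin V ->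
      dfs_run e a (w :: u :: st) (w |: V) ((u, w) :: E)
  | dfs_backtrack u st V E :
      dfs_run e a (u :: st) V E -> (forall w, w \in a -> e u w -> w \in V) ->
      dfs_run e a st V E.

Definition dfs_tree {T : finType} (e : rel T) (a : {set T}) (E : seq (T * T)) :
    Prop :=
  exists V : {set T}, dfs_run e a [::] V E.

Definition reramp_height {X Y : nat} (ir : nat) (a : {set pos X Y}) (h : nat) :
    Prop :=
  exists (v0 v1 vk : pos X Y) (E : seq (pos X Y * pos X Y)) (r : ramp (pos X Y)),
    [/\ [/\ border v0, v1 \in a & neighbor v0 v1],
        dfs_tree neighbor a E, vk \in a,
        rft ((v0, v1) :: E) ir v0 vk r & h = height r].

Definition worst_case_reramp_height {X Y : nat} (ir : nat) (a : {set pos X Y})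
    (w : nat) : Prop :=
  is_minimum (reramp_height ir a) w.

(* Main.v *)
(** Two bounds meet.  Along every plan, the height of a column of [a] exceeds by
    at most one the number of strictly lower columns of [a]: a block is delivered
    from a column of the same height, which thereby becomes strictly lower.  Hence
    n_a <= #|a|.  Conversely, if ReRamp reaches height h, then every position of
    [a] is within grid distance 2h of the neighbor v_1 of the root: the tree walk
    from v_1 to it leaves the central path into a branch whose longest path, of
    length m, spans a side ramp of reversible height at least (m - 1)/2, because
    even without side ramps of its own the backward ramp reaches half of its
    central path.  So [a] lies in a square of side 4h + 1 and n_a <= (5h)^2. *)

Require Import Defs.
From mathcomp Require Import all_boot all_order all_algebra reals.
From mathcomp Require Import zify.

Set Implicit Arguments.
Unset Strict Implicit.
Unset Printing Implicit Defensive.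

Local Open Scope nat_scope.

(** * Upper bound: no plan builds a column higher than the number of positions of [a] *)

Section ConstructionHeight.

Context {X Y : nat} (a : {set pos X Y}).
Hypothesis a_inner : forall u, u \in a -> ~~ border u.

(** The successor on the right accounts for the border: a block delivered from a border position,
    which lies outside [a], may raise a column to height 1 without any lower column in [a]. *)
Definition staircase (z : heights X Y) : Prop :=
  forall v, v \in a -> z v <= #|[set u in a | z u < z v]|.+1.

Definition confined (s : state X Y) : Prop :=
  forall u, agent s u != None -> (u \in a) || border u.

Lemma neighbor_sym (u v : pos X Y) : neighbor u v = neighbor v u.
Proof.
by rewrite /neighbor ![u.2 == _]eq_sym ![u.1 == _]eq_sym
  ![(u.1.+1 == _) || _]orbC ![(u.2.+1 == _) || _]orbC.
Qed.

Lemma neighbor_neq (u v : pos X Y) : neighbor u v -> u != v.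
Proof.
move=> nuv; apply/eqP => uv; move: nuv; rewrite uv /neighbor.
by rewrite !eqxx !(gtn_eqF (ltnSn _)).
Qed.

(** The raised column [v] gains [u] as a strictly lower column. Another column loses [v] from its
    lower set only if its height equals the new height of [v], and then the count in [raised] serves
    for it too. *)
Lemma staircase_deliver (z : heights X Y) u v :
  border_empty z -> staircase z -> (u \in a) || border u -> u != v ->
  v \in a -> z v = z u -> staircase (update z v (z v).+1).
Proof.
move=> z0 stz ua uv va zvu.
have raised : (z v).+1 <= #|[set x in a | update z v (z v).+1 x < (z v).+1]|.+1.
  (* If [u] is on the border, its height is 0, so the new height of [v] is 1 and the bound is
     immediate. *)
  case/orP: ua => [ua|/z0 zu0]; last by rewrite ltnS zvu zu0.
  rewrite ltnS; apply: leq_trans (stz v va) _; apply: proper_card.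
  apply/properP; split; last first.
    by exists u; rewrite !inE ua ?ffunE /= ?(negPf uv) ?zvu ?ltnSn ?ltnn.
  apply/subsetP => x; rewrite !inE ffunE => /andP[-> zx] /=.
  by case: eqP zx => [->|_]; [rewrite ltnn | move/ltnW].
move=> w wa; rewrite {1 3}/update !ffunE; case: eqP => [//|/eqP wv].
have [zw|zw] := eqVneq (z w) (z v).+1; first by rewrite zw.
apply: leq_trans (stz w wa) _; rewrite ltnS; apply: subset_leq_card.
apply/subsetP => x; rewrite !inE ffunE => /andP[-> zx] /=.
by case: eqP zx => [->|//] zx; rewrite ltn_neqAle eq_sym zw.
Qed.

(** Lowering a column can only enlarge the sets of lower columns ([mono]), and the lowered column
    gets exactly the height of [u], so it inherits the bound of [u], or has height 0 if [u] is on
    the border. *)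
Lemma staircase_pickup (z : heights X Y) u v :
  border_empty z -> staircase z -> (u \in a) || border u ->
  z v = (z u).+1 -> staircase (update z v (z v).-1).
Proof.
move=> z0 stz ua zvu.
have mono h : #|[set x in a | z x < h]| <= #|[set x in a | update z v (z v).-1 x < h]|.
  apply: subset_leq_card; apply/subsetP => x; rewrite !inE ffunE => /andP[-> zx] /=.
  by case: eqP zx => [->|//]; apply: leq_ltn_trans (leq_pred _).
move=> w wa; rewrite {1 3}/update !ffunE; case: eqP => [_|_]; last first.
  by apply: leq_trans (stz w wa) _; rewrite ltnS mono.
rewrite zvu /=; case/orP: ua => [ua|/z0 -> //].
by apply: leq_trans (stz u ua) _; rewrite ltnS -[X in update z v X]/((z u).+1.-1) -zvu mono.
Qed.

Definition safe (s : state X Y) : Prop :=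
  [/\ confined s, border_empty (height_of s) & staircase (height_of s)].

Lemma border_empty_update (z : heights X Y) v x :
  border_empty z -> v \in a -> border_empty (update z v x).
Proof.
move=> z0 /a_inner vb u ub; rewrite ffunE; case: eqP => [uv|_]; last exact: z0.
by rewrite -uv ub in vb.
Qed.

Lemma safe_perform s c : safe s -> admissible a s c -> safe (perform s c).
Proof.
case: s => z ag [/= cf z0 st]; case: c => /= [b t|b|u v|u v|u v|u] //=.
- move=> bb; split=> //= u; rewrite ffunE; case: (u =P b) => [-> _|_]; last exact: cf.
  by rewrite bb orbT.
- move=> _; split=> //= u; rewrite ffunE; case: (u =P b) => // _; exact: cf.
- case/and5P=> _ _ va _ _; split=> //= w; rewrite !ffunE.
  case: (w =P v) => [-> //|_]; case: (w =P u) => // _; exact: cf.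
- case/and4P=> /eqP agu nuv va /eqP zvu; have ua := cf u; rewrite agu in ua.
  split=> /=; [|exact: border_empty_update|
    exact: staircase_deliver z0 st (ua _) (neighbor_neq nuv) va zvu].
  by move=> w; rewrite ffunE; case: (w =P u) => [->|_]; [move=> _; exact: ua|exact: cf].
- case/and4P=> /eqP agu nuv va /eqP zvu; have ua := cf u; rewrite agu in ua.
  split=> /=; [|exact: border_empty_update|exact: staircase_pickup z0 st (ua _) zvu].
  by move=> w; rewrite ffunE; case: (w =P u) => [->|_]; [move=> _; exact: ua|exact: cf].
Qed.

Lemma perform_frame s (c : action X Y) w : w \notin involved c ->
  height_of (perform s c) w = height_of s w /\ agent (perform s c) w = agent s w.
Proof.
case: c => [b t|b|u v|u v|u v|u] //=; rewrite !inE ?negb_or => wc;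
  try (have /andP[wu wv] := wc); split=> //; rewrite !ffunE.
all: do ?[by rewrite !ifN].
Qed.

(** The preconditions of [d] read the state only at positions involved in [d]. Simultaneous actions
    can therefore be treated one after the other. *)
Lemma admissible_perform s c d : [disjoint involved c & involved d] ->
  admissible a s d -> admissible a (perform s c) d.
Proof.
rewrite disjoint_sym => /disjointFr dis.
have frame w : w \in involved d -> height_of (perform s c) w = height_of s w /\
    agent (perform s c) w = agent s w.
  by move=> wd; apply: perform_frame; rewrite dis.
case: d frame {dis} => //= [u|u v|u v|u v|u] frame.
all: have [|zu agu] := frame u; first by rewrite !inE eqxx.
all: try (have [|zv agv] := frame v; first by rewrite !inE eqxx orbT).
all: by rewrite ?zu ?zv ?agu.
Qed.

Lemma safe_timestep s s' : safe s -> timestep a s s' -> safe s'.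
Proof.
move=> sf [cs [adm dis _ ->{s'}]]; elim: cs s sf adm dis => //= c cs IH s sf.
case/andP=> admc adm /andP[disc dis]; apply: IH dis; first exact: safe_perform.
have /andP := conj disc adm; rewrite -all_predI; apply: sub_all => d /andP[].
exact: admissible_perform.
Qed.

Lemma safe_reachable s s' : safe s -> reachable a s s' -> safe s'.
Proof. by move=> sf; elim=> // s1 s2 _ IH; exact: safe_timestep. Qed.

(** A column is not lower than itself, so the set of lower columns is a proper subset of [a], which
    absorbs the successor. *)
Lemma staircase_bound (z : heights X Y) v : staircase z -> v \in a -> z v <= #|a|.
Proof.
move=> st va; apply: leq_trans (st v va) _; apply: proper_card.
apply/properP; split; last by exists v; rewrite // inE ltnn andbF.
by apply/subsetP => x; rewrite inE => /andP[].
Qed.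

Lemma ramp_height_le_card (z : heights X Y) h :
  border_empty z -> {in a, forall u, z u = 0} -> ramp_height_in z a h -> h <= #|a|.
Proof.
move=> z0 za [s rs ->]; have [|_ _ st] := safe_reachable _ rs.
  by split=> //= u; rewrite ?ffunE // => /za ->.
by apply/bigmax_leqP => u; apply: staircase_bound.
Qed.

End ConstructionHeight.

(** * Uniqueness of simple paths in forests *)

Section TreePaths.

Context {T : eqType}.
Implicit Types (E : seq (T * T)) (x u w : T) (p q : seq T).

(** Each new edge has a fresh end [w], which is then a leaf. The two constructors cover the two
    orientations: [forest_leaf] for a node discovered by depth-first search, [forest_root] for the
    border root added to the tree. *)
Inductive forest : seq (T * T) -> Prop :=
  | forest_nil : forest [::]
  | forest_leaf E u w : forest E -> u != w ->
      ~~ has (fun e => (e.1 == w) || (e.2 == w)) E ->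
      forest ((u, w) :: E)
  | forest_root E w u : forest E -> u != w ->
      ~~ has (fun e => (e.1 == w) || (e.2 == w)) E ->
      forest ((w, u) :: E).

Lemma tree_adj_sym E u w : tree_adj E u w = tree_adj E w u.
Proof. by rewrite /tree_adj orbC. Qed.

Lemma simple_path_rcons E x p w :
  simple_path E x (rcons p w) = [&& simple_path E x p, tree_adj E (last x p) w & w \notin x :: p].
Proof.
rewrite /simple_path rcons_path -rcons_cons rcons_uniq.
by case: path; case: uniq; case: tree_adj; case: (w \in _).
Qed.

(** Here [E'] is [E] with a leaf [w] hung on [u]. Stripping [w] from the ends of two simple paths
    leaves paths of [E] with common ends. *)
Lemma unique_path_leaf E E' u w :
  (forall x y, x != w -> y != w -> tree_adj E' x y = tree_adj E x y) ->
  (forall x, tree_adj E' w x -> x = u) ->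
  (forall x p q, simple_path E x p -> simple_path E x q -> last x p = last x q -> p = q) ->
  forall x p q, simple_path E' x p -> simple_path E' x q -> last x p = last x q -> p = q.
Proof.
move=> agree leaf uniqE.
have restrict x p : w \notin x :: p -> simple_path E' x p -> simple_path E x p.
  rewrite /simple_path => wxp /andP[pp ->]; rewrite andbT.
  elim: p x wxp pp => //= y p IH x; rewrite !inE !negb_or => /and3P[wx wy wp].
  case/andP; rewrite agree 1?eq_sym // => -> /=; apply: IH.
  by rewrite inE negb_or wy.
have leafl x : tree_adj E' x w -> x = u by rewrite tree_adj_sym => /leaf.
(* A simple path meets the leaf [w] only at its ends. *)
have ends x p : x != w -> simple_path E' x p -> w \in p -> last x p = w.
  move=> xw; elim/last_ind: p => // p y IH; rewrite simple_path_rcons last_rcons.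
  case/and3P=> sp xy yp; rewrite mem_rcons inE => /orP[/eqP //|wp].
  have lw := IH sp wp; rewrite lw in xy; have yu := leaf _ xy.
  case/lastP: p sp wp lw yp {IH xy} => // p z.
  rewrite simple_path_rcons last_rcons => /and3P[_ zp _] _ zw.
  rewrite zw in zp; rewrite yu -(leafl _ zp) -rcons_cons mem_rcons.
  by rewrite inE mem_last orbT.
have uniq_ne x p q : x != w -> simple_path E' x p -> simple_path E' x q ->
    last x p = last x q -> p = q.
  move=> xw sp sq pq; have [lw|lw] := eqVneq (last x p) w; last first.
    apply: (uniqE x _ _ _ _ pq); apply: restrict => //; rewrite inE negb_or eq_sym xw /=.
      by apply: contra lw => /(ends _ _ xw sp) ->.
    by rewrite pq in lw; apply: contra lw => /(ends _ _ xw sq) ->.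
  have qw : last x q = w by rewrite -pq.
  case/lastP: p sp lw {pq} => [_ /= xw'|p y]; first by rewrite xw' eqxx in xw.
  case/lastP: q sq qw => [_ /= xw'|q y']; first by rewrite xw' eqxx in xw.
  rewrite !last_rcons !simple_path_rcons => /and3P[sq qy' y'q] y'w /and3P[sp py yp] yw.
  subst y y'; congr rcons; apply: (uniqE x); [exact: restrict|exact: restrict|].
  by rewrite (leafl _ py) (leafl _ qy').
move=> x p q; have [->|xw] := eqVneq x w; last exact: uniq_ne.
case: p => [|y p]; case: q => [|y' q] //.
- by case/andP=> _ _ /andP[_] /= /andP[wq _] wl; rewrite wl mem_last in wq.
- by case/andP=> _ /= /andP[wq _] _ wl; rewrite -wl mem_last in wq.
move=> /andP[/= /andP[wy pp] /andP[wp up]] /andP[/= /andP[wy' pq] /andP[wq uq]] ll.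
have yu := leaf _ wy; have y'u := leaf _ wy'; subst y y'; congr cons.
apply: (uniqE u); [apply: restrict wp _|apply: restrict wq _|exact: ll].
  by rewrite /simple_path pp.
by rewrite /simple_path pq.
Qed.

Lemma forest_unique_path E : forest E -> forall x p q,
  simple_path E x p -> simple_path E x q -> last x p = last x q -> p = q.
Proof.
have tree_adj_leaf E' u w x : ~~ has (fun e => (e.1 == w) || (e.2 == w)) E' ->
    tree_adj E' w x = false.
  move=> wE; apply/negbTE; apply: contra wE => /orP[] wx; apply/hasP;
    by eexists; [exact: wx|rewrite /= eqxx ?orbT].
elim=> [|E' u w _ IH uw wE|E' w u _ IH uw wE].
- by move=> x [|? ?] [|? ?].
all: apply: (unique_path_leaf (u := u) (w := w) _ _ IH); [move=> x y xw yw|move=> x];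
  rewrite /tree_adj !inE !xpair_eqE.
- by rewrite (negPf xw) (negPf yw) !andbF.
- rewrite orbACA -/(tree_adj E' w x) (tree_adj_leaf _ u) // orbF eqxx andbT eq_sym (negPf uw).
  by move=> /eqP.
- by rewrite (negPf xw) (negPf yw) ?andbF.
- rewrite orbACA -/(tree_adj E' w x) (tree_adj_leaf _ u) // orbF eqxx /= [w == u]eq_sym.
  rewrite (negPf uw) andbF orbF.
  by move=> /eqP.
Qed.

End TreePaths.

(** * Depth-first search yields a spanning tree *)

Section DepthFirstSearch.

Context {T : finType} (e : rel T) (a : {set T}).

(** The third clause holds because a node leaves the stack only once its neighbors are visited; with
    an empty stack it makes [V] closed under neighbors in [a]. *)
Lemma dfs_run_invariant st (V : {set T}) E : dfs_run e a st V E ->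
  [/\ V \subset a, {subset st <= V},
      {in V, forall u, u \notin st -> forall w, w \in a -> e u w -> w \in V},
      forest E & (forall u w, (u, w) \in E -> [/\ u \in V, w \in V & e u w])
   /\ exists2 x, x \in V & {in V, forall u, connect (tree_adj E) x u}].
Proof.
elim=> [u ua|u st' V' E' w _ [Va stV clV fE [EV [x xV con]]] wa uw wV|
        u st' V' E' _ [Va stV clV fE [EV con]] done_u].
- split=> //; first by rewrite sub1set.
  + by move=> w; rewrite !inE.
  + by move=> w; rewrite !inE => /eqP ->; rewrite eqxx.
  + exact: forest_nil.
  + by split=> //; exists u => [|w]; rewrite inE // => /eqP ->.
- have uV : u \in V' by apply: stV; rewrite mem_head.
  split.
  + by rewrite subUset sub1set wa.
  + by move=> v; rewrite !inE => /or3P[->//|/eqP->|/(@mem_behead _ (u :: _))/stV ->];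
      rewrite ?uV orbT.
  + move=> v; rewrite in_setU1 in_cons negb_or => /orP[->//|vV] /andP[_ vst] y ya vy.
    by rewrite in_setU1 (clV v) ?orbT.
  + apply: forest_leaf fE _ _; first by apply: contraNneq wV => <-.
    apply/hasPn => -[y z] /EV [yV zV _] /=; rewrite negb_or.
    by rewrite !(contraNneq _ wV) // => <-.
  + split.
      move=> y z; rewrite in_cons !in_setU1 => /orP[/eqP[-> ->]|/EV[-> -> ->]].
        by rewrite eqxx uV uw orbT.
      by rewrite !orbT.
    have sub : subrel (tree_adj E') (tree_adj ((u, w) :: E')).
      by move=> y z; rewrite /tree_adj !in_cons => /orP[] ->; rewrite !orbT.
    exists x; first by rewrite in_setU1 xV orbT.
    have mono y : connect (tree_adj E') x y -> connect (tree_adj ((u, w) :: E')) x y.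
      by apply: connect_sub => ? ? /sub /connect1.
    move=> y; rewrite in_setU1 => /orP[/eqP->|/con]; last exact: mono.
    apply: connect_trans (mono _ (con u uV)) (connect1 _).
    by rewrite /tree_adj mem_head.
- split=> //; first by move=> v vst; apply: stV; rewrite inE vst orbT.
  move=> v vV vst; have [->//|vu] := eqVneq v u.
  by apply: (clV v vV); rewrite inE negb_or vu.
Qed.

(** Connectedness of [a] is stated through closed subsets, the form in which it applies directly to
    the final visited set. *)
Lemma dfs_treeP E :
  (forall B : {set T}, B \subset a -> B != set0 ->
     {in B, forall u w, w \in a -> e u w -> w \in B} -> B = a) ->
  dfs_tree e a E ->
  [/\ forest E, forall u w, (u, w) \in E -> [/\ u \in a, w \in a & e u w] &
      {in a &, forall u w, connect (tree_adj E) u w}].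
Proof.
move=> conn [V /dfs_run_invariant [Va _ clV fE [EV [x xV con]]]].
have <- // : V = a.
  apply: conn => // [|u uV w]; last exact: clV.
  by apply/set0Pn; exists x.
split=> // u w /con xu /con; apply: connect_trans.
by rewrite (sym_connect_sym (tree_adj_sym E)).
Qed.

End DepthFirstSearch.

(** * Lower bound: the reversible height is about half the length of the central path *)

Section ReversibleHeight.

Context {T : eqType}.
Implicit Types (r s : ramp T) (BF : ramp T * ramp T).

Lemma leq_sumn_map (I : eqType) (F G : I -> nat) (l : seq I) :
  {in l, forall i, F i <= G i} -> sumn (map F l) <= sumn (map G l).
Proof.
elim: l => //= i l IH FG; apply: leq_add; first exact: FG (mem_head i l).
by apply: IH => j jl; apply: FG; rewrite inE jl orbT.
Qed.

Lemma sumn_iota_leq m n : m <= n -> sumn (iota 0 m) <= sumn (iota 0 n).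
Proof. by move=> /subnKC <-; rewrite iotaD sumn_cat leq_addr. Qed.

Lemma level_ge r i : i <= size (nodes r) -> i <= level r i.
Proof.
case: r => v0 p sd f /= ip.
have {1}-> : i = sumn [seq 1 | v <- take i (v0 :: p)].
  by rewrite sumnE big_map sum1_size size_take_min; apply/esym/minn_idPl.
exact: leq_sumn_map.
Qed.

Lemma capacity_without_sides v0 (p : seq T) f :
  capacity (Ramp v0 p [::] f) = sumn (iota 0 (size p).+1).
Proof.
rewrite -[in RHS](map_id (iota _ _)) /capacity -/capacity; congr sumn; apply/eq_in_map => i.
rewrite mem_iota add0n => /andP[_ ip]; rewrite addn0.
by rewrite /level sumnE big_map sum1_size size_take_min; apply/minn_idPl/ltnW.
Qed.

Lemma capacity_ge v0 (p : seq T) sd f :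
  sumn (iota 0 (size p).+1) <= capacity (Ramp v0 p sd f).
Proof.
rewrite -[iota _ _]map_id; apply: leq_sumn_map => i.
rewrite mem_iota add0n => /andP[_ ip]; apply: leq_trans (leq_addr _ _).
exact: (@level_ge (Ramp v0 p sd f) i (ltnW ip)).
Qed.

(** The assumption on capacities lets the backward ramp grow whenever it has fewer edges than the
    forward one. Hence the forward ramp, with [m - j] edges, is never longer by more than one edge
    than the backward one, with [i] edges; when they meet, [m - i <= i + 1]. *)
Lemma meeting_point_bound capB capF m fuel i j :
  (forall i j, i < m - j -> capB i.+1 <= capF j) ->
  j - i <= fuel -> i <= j -> j <= m -> m - j <= i.+1 ->
  meeting_point capB capF fuel i j <= m <= (meeting_point capB capF fuel i j).*2.+1.
Proof.
move=> cap; elim: fuel i j => [|fuel IH] i j jf ij jm mj /=; first lia.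
case: (ltnP i j) => [ltij|]; last lia.
case: (leqP (capB i.+1) (capF j)) (@cap i j) => [_ _|_ nocap]; first by apply: IH; lia.
have {nocap} : m - j <= i by rewrite leqNgt; apply/negP => /nocap.
move=> mji.
by apply: IH; lia.
Qed.

(** The chosen reversal is at least as high as the one whose backward ramp has no side ramps. There
    the backward capacity is a triangular number, while side ramps can only increase the forward
    capacity, so [meeting_point_bound] applies. *)
Lemma reversal_rrh_ge r BF : reversal r BF -> size (nodes r) <= (rrh BF).*2.+2.
Proof.
move=> rev_r; have : rrh (split_without_sides r) <= rrh BF.
  by case: rev_r => BF1 _ [[-> //]|[->]].
case: r {rev_r} => v0 p sd f; rewrite /split_without_sides /rrh /= addn0 size_rev.
set j := pivot _ _ _; suff /andP[jp pj] : j <= size p <= j.*2.+1.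
  rewrite size_take_min /=; lia.
apply: meeting_point_bound => //; rewrite ?subnn ?leq_subr // => i j' lt_i.
rewrite /backward_ramp /forward_ramp capacity_without_sides size_rev size_take_min.
apply: leq_trans (capacity_ge _ _ _ _); apply: sumn_iota_leq.
rewrite size_drop /=; lia.
Qed.

(** A kept candidate contributes its height to the sum; a skipped one has reversible height 0. *)
Lemma add_sides_rrh E build cs (sd : seq (ramp T * ramp T)) vi vc :
  add_sides E build cs sd -> (vi, vc) \in cs ->
  exists nd s BF, [/\ farthest E vi vc nd, build vi nd s, reversal s BF &
                     rrh BF <= sumn [seq height t.1 | t <- sd]].
Proof.
elim=> // {cs sd} [v c nd s BF cs sd far bs rs _ _ IH|v c nd s BF cs sd far bs rs r0 _ IH].
- rewrite in_cons => /orP[/eqP[-> ->]|/IH[nd' [s' [BF' [? ? ? le']]]]].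
    by exists nd, s, BF; split=> //=; exact: leq_addr.
  by exists nd', s', BF'; split=> //=; apply: leq_trans le' (leq_addl _ _).
- rewrite in_cons => /orP[/eqP[-> ->]|//].
  by exists nd, s, BF; rewrite r0.
Qed.

End ReversibleHeight.

(** * Distances within the ramp area, bounded by the height of ReRamp *)

Lemma path_exit (T : eqType) (e : rel T) (P : pred T) x q :
  path e x q -> has P (x :: q) -> ~~ P (last x q) ->
  exists v c q', [/\ P v, e v c, path e c q', ~~ has P (c :: q') & last c q' = last x q].
Proof.
elim: q x => [x _ /=|y q IH x /= /andP[xy yq] hasP Pl]; first by rewrite orbF => ->.
(* Recursing as long as [P] holds further on makes [v] the last node satisfying [P]. *)
have [Pyq|nPyq] := boolP (has P (y :: q)); first exact: IH yq Pyq Pl.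
exists x, y, q; split=> //; move: hasP nPyq => /= /orP[//|Pyq].
by rewrite Pyq.
Qed.

Section ReRampHeight.

Context {X Y : nat}.
Implicit Types (a : {set pos X Y}) (u v w : pos X Y).

Definition within (d : nat) u v : bool :=
  [&& u.1 <= v.1 + d, v.1 <= u.1 + d, u.2 <= v.2 + d & v.2 <= u.2 + d].

Lemma within_leq d d' u v : d <= d' -> within d u v -> within d' u v.
Proof. by move=> dd' /and4P[]; rewrite /within; move=> *; apply/and4P; split; lia. Qed.

Lemma within_trans d d' u v w : within d u v -> within d' v w -> within (d + d') u w.
Proof.
by move=> /and4P[? ? ? ?] /and4P[? ? ? ?]; apply/and4P; split; lia.
Qed.

Lemma path_within u q : path neighbor u q -> within (size q) u (last u q).
Proof.
rewrite /within; elim: q u => [|v q IH] u /=; first lia.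
by case/andP=> + /IH; rewrite /neighbor -!val_eqE /=; lia.
Qed.

Lemma card_within a v d : {in a, forall u, within d v u} -> #|a| <= d.*2.+1 ^ 2.
Proof.
(* Adding [d] first keeps the natural subtraction exact and puts the shifted coordinates of
   positions of [a] between 0 and [2d]. *)
move=> av; pose shift u : 'I_d.*2.+1 * 'I_d.*2.+1 :=
  (inord (u.1 + d - v.1), inord (u.2 + d - v.2)).
have inj_shift : {in a &, injective shift}.
  move=> [u1 u2] [w1 w2] /av /and4P[/= u1l u1r u2l u2r] /av /and4P[/= w1l w1r w2l w2r].
  case=> /(congr1 val) /= + /(congr1 val) /= +.
  rewrite !inordK; [|lia..] => e1 e2.
  by congr pair; apply: val_inj => /=; lia.
rewrite -(card_in_imset inj_shift) (leq_trans (max_card _)) // card_prod card_ord.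
by rewrite mulnn.
Qed.

Lemma ramp_area_inner (z : heights X Y) a : ramp_area z a ->
  {in a, forall u, ~~ border u /\ z u = 0}.
Proof.
by case=> -[u0 _ ->] _ u; rewrite !inE => /andP[/andP[ub /eqP zu] _].
Qed.

Lemma ramp_area_connected (z : heights X Y) a (B : {set pos X Y}) : ramp_area z a ->
  B \subset a -> B != set0 ->
  {in B, forall u w, w \in a -> neighbor u w -> w \in B} -> B = a.
Proof.
case=> -[u0 u0z ->] _ /subsetP; set e := [rel x y | _]; set A := [set v in _ | _] => Ba.
case/set0Pn=> b bB clB; apply/eqP; rewrite eqEsubset; apply/andP; split; first exact/subsetP.
have esym : connect_sym e.
  by apply: sym_connect_sym => x y; rewrite /= neighbor_sym andbCA.
have memA x : (x \in A) = (x \in free_positions z) && connect e u0 x by rewrite in_set.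
have clA x y : x \in A -> e x y -> y \in A.
  rewrite !memA => /andP[_ u0x] exy; have /and3P[_ -> _] := exy.
  by rewrite (connect_trans u0x (connect1 (e := e) exy)).
apply/subsetP => w wA; have : connect e b w.
  move: (Ba b bB) wA; rewrite !memA => /andP[_ u0b] /andP[_]; apply: connect_trans.
  by rewrite esym.
case/connectP=> q bq ->{w wA}; elim: q b bB bq => //= x q IH b bB /andP[bx].
apply: IH; apply: (clB b) => //; first exact: clA (Ba b bB) bx.
by case/and3P: bx.
Qed.

Lemma rft_path (T : finType) (E : seq (T * T)) ir root vk r : rft E ir root vk r ->
  exists p sd, [/\ simple_path E root p, last root p = vk & r = Ramp root p sd 0].
Proof. by case: ir => [|ir] [p [sd [? ? ? _]]]; exists p, sd. Qed.

Lemma reramp_within (z : heights X Y) ir a h : ramp_area z a -> reramp_height ir.+1 a h ->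
  0 < h /\ exists v, {in a, forall u, within h.*2 v u}.
Proof.
move=> za [v0 [v1 [vk [E [r [[v0b v1a v01] dfsE vka]]]]]].
have [fE EV conn] := dfs_treeP (fun B => @ramp_area_connected _ _ B za) dfsE.
(* Being on the border, [v0] is on no edge of [E]; in [E'] it is a leaf attached to [v1]. *)
have v0a : v0 \notin a by apply: contraL v0b => /(ramp_area_inner za)[].
have v0E u : ((v0, u) \in E = false) * ((u, v0) \in E = false).
  by split; apply/negP => /EV[]; rewrite (negPf v0a).
set E' := (v0, v1) :: E.
have v0adj c : tree_adj E' v0 c -> c = v1.
  rewrite /tree_adj !in_cons !v0E !orbF !xpair_eqE eqxx /= => /orP[/eqP //|].
  by case/andP=> /eqP -> /eqP.
have fE' : forest E'.
  apply: forest_root fE _ _; first by rewrite eq_sym neighbor_neq.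
  by apply/hasPn => -[x y] /EV[xa ya _]; rewrite negb_or !(contraNneq _ v0a) //= => <-.
have adjn u w : tree_adj E' u w -> neighbor u w.
  by case/orP; rewrite in_cons => /orP[/eqP[-> ->]|/EV[]] //; rewrite neighbor_sym.
have pathn u q : path (tree_adj E') u q -> path neighbor u q by exact: sub_path.
case=> [p [sd [/andP[v0p up] lp -> [cs [children childrenE ->] sides]]]] ->{h r}.
(* The central path has an edge, as [vk] is in [a] and the root is not. This gives [0 < h]. *)
case: p v0p up lp childrenE sides => [_ _ /= v0k|v p].
  by rewrite v0k vka in v0a.
move=> /= /andP[/v0adj ->{v} v1p] up lp childrenE sides; split=> //.
exists v1 => u ua; set P := v0 :: v1 :: p in up childrenE.
have u0 : u != v0 by apply: contraNneq v0a => <-.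
have [uP|uP] := boolP (u \in P).
  move: uP; rewrite in_cons (negPf u0) /= => uP.
  case/splitPl: uP v1p {sides lp up} @P childrenE => p1 p2 <-.
  rewrite cat_path => /andP[/pathn/path_within].
  rewrite /within /= size_cat; lia.
have /connectP[q v1q lq] : connect (tree_adj E') v1 u.
  apply: connect_sub (conn _ _ v1a ua) => x y xy; apply: connect1.
  by move: xy; rewrite /tree_adj !in_cons => /orP[] ->; rewrite !orbT.
(* The tree walk from [v1] to [u] leaves the central path for good at [vi], entering the branch of
   [vc]. *)
have [||vi [vc [q']]] := @path_exit _ _ (mem P) _ _ v1q.
- by rewrite /= !inE eqxx orbT.
- by rewrite -lq.
case=> viP ic cq' cP lq'; have vcP : vc \notin P by apply: contra cP => /= ->.
(* RFT skips the root, so [vi] must differ from [v0]: the only neighbor of [v0] is [v1], which is on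
   the central path. *)
have vip : vi \in v1 :: p.
  move: viP; rewrite /= in_cons => /orP[/eqP vi0|//].
  by rewrite vi0 in ic; rewrite (v0adj _ ic) !inE eqxx orbT in vcP.
have cand : (vi, vc) \in flatten [seq [seq (v, c) | c <- children v] | v <- rev (v1 :: p)].
  apply/flatten_mapP; exists vi; rewrite ?mem_rev //; apply: map_f.
  by rewrite (perm_mem (childrenE vi)) mem_enum inE ic.
have [nd [s [BF [[q2 [sq2 viq2 lq2 max2]] /rft_path[ps [sds [sps lps ->]]]]]]] :=
  add_sides_rrh sides cand.
(* By uniqueness of tree paths, the side ramp runs along the longest path [q2] of the branch. *)
move=> /reversal_rrh_ge; have -> : ps = vc :: q2.
  apply: (forest_unique_path fE' sps); last by rewrite lps.
  case/andP: sq2 => pq2 uq2; rewrite /simple_path cons_uniq viq2 uq2 /= pq2 /=.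
  by rewrite ic.
(* The rest of the walk is made simple so that the maximality of [q2] bounds its length. *)
case/shortenP: cq' lq' cP => q3 cq3 uq3 sub3 lq3 cP.
have viq3 : vi \notin vc :: q3.
  apply: contra cP => vi3; apply/hasP; exists vi => //.
  by move: vi3; rewrite !in_cons => /orP[->//|/sub3 ->]; rewrite orbT.
have := max2 q3; rewrite /simple_path cq3 uq3 => /(_ isT viq3).
have := path_within (pathn _ _ cq3); rewrite lq3 -lq => c3u size3 rrhBF rrhS.
have icw : within 1 vi vc by apply: (@path_within vi [:: vc]); rewrite /= adjn.
case/splitPl: vip v1p rrhS => p1 p2 lp1.
rewrite cat_path => /andP[/pathn/path_within]; rewrite lp1 => c1i _ rrhS.
apply: within_leq (within_trans c1i (within_trans icw c3u)).
(* The distance is at most [size p1 + 1 + size q3], where [size q3 <= size q2 <= 2 * rrh BF]; the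
   edge from [v0] to [v1], counted in the height, pays for the 1. *)
rewrite /= size_cat; move: rrhBF size3 rrhS; clear; move: (sumn _) (rrh BF); rewrite /=; lia.
Qed.

End ReRampHeight.


(** * Combination of the two bounds *)

Lemma max_construction_height_le (X Y ir na w : nat) (z : heights X Y) (a : {set pos X Y}) :
  border_empty z -> ramp_area z a -> max_construction_height z a na ->
  reramp_height ir.+1 a w -> na <= (5 * w) ^ 2.
Proof.
move=> z0 za [na_h _] /(reramp_within za)[w0 [v av]].
have inner := ramp_area_inner za.
have := ramp_height_le_card (fun u ua => (inner u ua).1) z0 (fun u ua => (inner u ua).2) na_h.
move=> /leq_trans -> //; apply: leq_trans (card_within av) _.
(* The side [4w + 1] is at most [5w] because [w] is positive. *)
rewrite leq_exp2r //; lia.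
Qed.

Import Order.TTheory GRing.Theory Num.Theory.
Local Open Scope ring_scope.

Theorem lemma8 (R : realType) (ir : nat) (ir_ge1 : (1 <= ir)%N) :
  exists (C : R) (n0 : nat),
    0 < C /\ (0 < n0)%N /\
    forall (X Y : nat) (z : heights X Y) (a : {set pos X Y}),
      border_empty z -> ramp_area z a ->
      forall na w : nat,
        max_construction_height z a na -> (n0 <= na)%N ->
        worst_case_reramp_height ir a w ->
        C * Num.sqrt (na%:R) <= w%:R.
Proof.
(* The constant [5^-1] results from taking square roots in [na <= (5 * w) ^ 2]. *)
case: ir ir_ge1 => // ir _; exists 5^-1, 1%N; split; first by rewrite invr_gt0.
split=> // X Y z a z0 za na w na_max _ [w_h _].
have := max_construction_height_le z0 za na_max w_h.
rewrite -(ler_nat R) natrX natrM => /ler_wsqrtr.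
rewrite sqrtr_sqr ger0_norm ?mulr_ge0 // => le5w.
by rewrite ler_pdivrMl.
Qed.
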